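(* Let $0<p<1$, let $\{X_n,\ n\ge1\}$ be the steps of the elephant random walk that remembers only the first and the most recent step, with $P(X_1=1)=p=1-P(X_1=-1)$, let $S_n=\sum_{k=1}^n X_k$, and let $$\sigma_T^2=1+\frac{(2p-1)(4p^2-24p+19)}{(3-2p)^3},\qquad\sigma_T>0.$$ Then, as $n\to\infty$, $$\frac{S_n-\frac{(2p-1)X_1}{3-2p}\,n}{\sigma_T\sqrt n}$$ converges in distribution to the standard normal law.
   Context: Elephant random walk remembering only the first and the most recent step: $X_2=X_1$ with probability $p$ and $X_2=-X_1$ with probability $1-p$; for every $n\ge2$, choose $K$ uniformly on $\{1,n\}$ and set $X_{n+1}=X_K$ with probability $p$ and $X_{n+1}=-X_K$ with probability $1-p$. All index choices and sign choices are mutually independent and independent of $X_1$. *)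

(* Defs.v *)
From HB Require Import structures.
From mathcomp Require Import all_boot all_order all_algebra finmap.
From mathcomp Require Import all_classical all_reals all_analysis.
From mathcomp Require Import measurable_realfun.

Set Implicit Arguments.
Unset Strict Implicit.
Unset Printing Implicit Defensive.

Import Order.TTheory GRing.Theory Num.Theory.
Import numFieldNormedType.Exports.

Local Open Scope classical_set_scope.
Local Open Scope ring_scope.

Definition rv_sigma_algebra d d' (T : measurableType d)
    (T' : measurableType d') (R : realType) (P : probability T R)
    (Y : {RV P >-> T'}) : set_system T :=
  preimage_set_system setT Y measurable.

(* Stated for families of classes of events, so that random variables with
   values in different spaces can be mixed via [rv_sigma_algebra]. *)
Definition mutually_independent d (T : measurableType d) (R : realType)
    (P : probability T R) (I : choiceType) (F : I -> set_system T) : Prop :=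
  forall (J : {fset I}) (E : I -> set T),
    (forall i, i \in J -> F i (E i)) ->
    P (\bigcap_(i in [set` J]) E i) = (\prod_(i <- J) P (E i))%E.

Definition cvg_in_distribution d (T : measurableType d) (R : realType)
    (P : probability T R) (Y : nat -> {RV P >-> R})
    (mu : probability (measurableTypeR R) R) : Prop :=
  forall x : R,
    {for x, continuous (fun t : R => mu `]-oo, t]%classic)} ->
    cdf (Y n) x @[n --> \oo] --> mu `]-oo, x]%classic.

Section elephant_random_walk.
Context d (T : measurableType d) (R : realType) (P : probability T R).
Variables (X : nat -> {RV P >-> R}) (K : nat -> {RV P >-> nat})
  (B : nat -> {RV P >-> bool}).

(* Steps are numbered from 1, so [X 0] plays no role. For n >= 2, [K n] is the
   index remembered when forming the step n + 1; for n >= 1, [B n] tells whether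
   the step n + 1 repeats ([true]) or reverses ([false]) the remembered one.
   The family below therefore lists X_1, K_2, K_3, ... and B_1, B_2, ... *)
Definition erw_sources (i : option (nat + nat)) : set_system T :=
  match i with
  | None => rv_sigma_algebra (X 1%N)
  | Some (inl n) => rv_sigma_algebra (K n.+2)
  | Some (inr n) => rv_sigma_algebra (B n.+1)
  end.

(* The recursions hold almost surely because the law of [K n] puts it in {1, n}
   only almost surely. *)
Record erw_first_last (p : R) : Prop := {
  erw_sources_independent : mutually_independent P erw_sources ;
  erw_index_first : forall n, (2 <= n)%N ->
    P [set w | K n w = 1%N] = (2^-1)%:E ;
  erw_index_last : forall n, (2 <= n)%N ->
    P [set w | K n w = n] = (2^-1)%:E ;
  erw_sign_keep : forall n, (1 <= n)%N -> P [set w | B n w = true] = p%:E ;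
  erw_sign_flip : forall n, (1 <= n)%N ->
    P [set w | B n w = false] = (1 - p)%:E ;
  erw_second_step : {ae P, forall w,
    X 2%N w = if B 1%N w then X 1%N w else - X 1%N w} ;
  erw_next_step : forall n, (2 <= n)%N -> {ae P, forall w,
    X n.+1 w = if B n w then X (K n w) w else - X (K n w) w}
}.

Definition erw_position (n : nat) : {RV P >-> R} :=
  \sum_(1 <= k < n.+1) X k.

End elephant_random_walk.

(* Main.v *)
(** Given X_1 = x, the steps form a two-state Markov chain. Put
m = (2p-1)/(3-2p). The centred step xi_k = X_k - m x satisfies
E[xi_(k+1) | X_k] = m/(1+m) xi_k, so that S_k - m k x + m xi_k is a martingale.
The law is identified without Fourier analysis: the smoothed indicator
Phi((b - z) / sqrt t) solves the heat equation in (t, z) explicitly, hence along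
the rescaled martingale its expectation changes by O(c^3) per step, with
c = 1/(sigma_T sqrt n), once a corrector of order c^2 has absorbed the
fluctuation of the conditional variance. Summing the n errors and then letting
the smoothing parameter tend to 0 gives the convergence of the distribution
function. *)

Require Import Defs.
From HB Require Import structures.
From mathcomp Require Import all_boot all_order all_algebra finmap.
From mathcomp Require Import all_classical all_reals all_analysis.
From mathcomp Require Import measurable_realfun.
From mathcomp Require Import ring lra.

Import Order.TTheory GRing.Theory Num.Theory.
Import numFieldNormedType.Exports.

Local Open Scope classical_set_scope.
Local Open Scope ring_scope.

Set Implicit Arguments.
Unset Strict Implicit.
Unset Printing Implicit Defensive.

(** * The Gaussian solution of the heat equation *)

Section Gauss.
Context {R : realType}.

(** Given the first step x and the last step y, the next step has mean r(x + y) with r = (2p-1)/2,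
    and m is the solution of m = r(1 + m). The martingale increment (1+m) xi' - m xi has conditional
    variance sigma_T^2 - 2 m^2 x xi. The second term is the obstacle: bounded crudely, it costs
    order c^2 at each of about c^-2 steps. As xi shrinks by r in mean, a corrector proportional to x
    xi absorbs it. The derivatives of the heat solution blow up at time 0, so the smoothing time t0
    > 0 is fixed before n grows. No conditional expectation is used: for a given first step,
    expectations are a finite deterministic recursion, and probability enters only through events on
    finitely many sources. *)

Definition std_pdf (z : R) : R := normal_pdf 0 1 z.
Definition std_cdf (z : R) : R := fine (normal_prob (0 : R) 1 `]-oo, z]).

Lemma std_pdfE z : std_pdf z = normal_peak 1 * expR (- (z ^+ 2 / 2)).
Proof.
rewrite /std_pdf normal_pdfE ?oner_eq0//.
by rewrite /normal_fun subr0 expr1n mulNr.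
Qed.

Lemma is_derive_std_pdf (z : R) : is_derive z 1 std_pdf (- z * std_pdf z).
Proof.
have -> : std_pdf = fun x => normal_peak 1 * expR (- (x ^+ 2 / 2)).
  by apply/funext => x; exact: std_pdfE.
apply: is_derive_eq.
rewrite /GRing.scale/=; by field.
Qed.

Lemma is_derive_std_cdf (z : R) : is_derive z 1 std_cdf (std_pdf z).
Proof.
(* The fundamental theorem of calculus is applied at an interior point of the interval, hence the
   margin 1. *)
have int : lebesgue_measure.-integrable `]-oo, z + 1] (EFin \o @std_pdf).
  apply: (integrableS measurableT) => //.
  exact: integrable_normal_pdf.
have zu : z < z + 1 by rewrite ltrDl.
have cz : {for z, continuous std_pdf}.
  by apply: continuous_normal_pdf; exact: oner_neq0.
have [D1 D2] := continuous_FTC1 zu int (ltNyr _) cz.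
have -> : std_cdf = fun x : R => \int[lebesgue_measure]_(t in [set` `]-oo, x]]) std_pdf t.
  by [].
by apply: DeriveDef D1 _; rewrite -derive1E.
Qed.

Lemma std_cdf_ge0 z : 0 <= std_cdf z.
Proof. by rewrite fine_ge0. Qed.

Lemma std_cdf_le1 z : std_cdf z <= 1.
Proof. by rewrite -lee_fin fineK ?fin_num_measure//; exact: probability_le1. Qed.

Lemma std_cdf_nondecreasing : nondecreasing_fun std_cdf.
Proof.
move=> x y xy; apply: fine_le; rewrite ?fin_num_measure//.
by rewrite le_measure ?inE//; exact: subitvPr.
Qed.

(** Under [normal_prob 0 1] the identity is a random variable whose distribution function is
    [std_cdf], so the general limits of distribution functions apply. *)
Let idR : measurableTypeR R -> R := idfun.

#[local] HB.instance Definition _ :=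
  @isMeasurableFun.Build _ _ _ _ idR (@measurable_id _ _ setT).

Lemma cvg_std_cdfNy : std_cdf x @[x --> -oo] --> (0 : R).
Proof.
apply: fine_cvg.
exact: (@cvg_cdfNy0 _ _ R _ (idR : {RV (normal_prob (0 : R) 1) >-> R})).
Qed.

Lemma cvg_std_cdfy : std_cdf x @[x --> +oo] --> (1 : R).
Proof.
apply: fine_cvg.
exact: (@cvg_cdfy1 _ _ R _ (idR : {RV (normal_prob (0 : R) 1) >-> R})).
Qed.

(** The derivative of [rsqrt] is a polynomial in [rsqrt], so every derivative of the heat solution
    is a polynomial in y and [rsqrt t] times the density. *)
Definition rsqrt (t : R) : R := (Num.sqrt t)^-1.

Lemma is_derive_rsqrt (t : R) : 0 < t -> is_derive t 1 rsqrt (- (rsqrt t ^+ 3 / 2)).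
Proof.
move=> t0; have st0 : Num.sqrt t != 0 by rewrite gt_eqF// sqrtr_gt0.
have h := is_derive1_sqrt t0.
apply: is_derive_eq; first exact: (is_deriveV st0 h).
rewrite /rsqrt /GRing.scale/=; by field; rewrite ?st0.
Qed.

(* [heat0] solves the heat equation u_t = u_yy / 2, and [heatk] is its k-th
   derivative in y. *)
Definition heat0 (t y : R) : R := std_cdf (y * rsqrt t).
Definition heat1 (t y : R) : R := rsqrt t * std_pdf (y * rsqrt t).
Definition heat2 (t y : R) : R := - (y * rsqrt t ^+ 3) * std_pdf (y * rsqrt t).
Definition heat3 (t y : R) : R :=
  (y ^+ 2 * rsqrt t ^+ 5 - rsqrt t ^+ 3) * std_pdf (y * rsqrt t).
Definition heat4 (t y : R) : R :=
  (3 * y * rsqrt t ^+ 5 - y ^+ 3 * rsqrt t ^+ 7) * std_pdf (y * rsqrt t).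

Lemma is_derive_scaled (f : R -> R) (df t y : R) :
  is_derive (y * rsqrt t) 1 f df ->
  is_derive y 1 (fun y => f (y * rsqrt t)) (df * rsqrt t).
Proof.
move=> h; have hg : is_derive y 1 (fun y : R => y * rsqrt t) (rsqrt t).
  by apply: is_derive_eq; rewrite /GRing.scale/=; ring.
exact: (@is_derive1_comp R f (fun y : R => y * rsqrt t) y _ _ h hg).
Qed.

Lemma is_derive_heat0 (t y : R) : is_derive y 1 (heat0 t) (heat1 t y).
Proof.
have h := is_derive_scaled (is_derive_std_cdf (y * rsqrt t)).
by apply: is_derive_eq; rewrite /heat1 mulrC.
Qed.

Lemma is_derive_heat1 (t y : R) : is_derive y 1 (heat1 t) (heat2 t y).
Proof.
have h := is_derive_scaled (is_derive_std_pdf (y * rsqrt t)).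
by apply: is_derive_eq; rewrite /heat2 /GRing.scale/=; ring.
Qed.

Lemma is_derive_heat2 (t y : R) : is_derive y 1 (heat2 t) (heat3 t y).
Proof.
have h := is_derive_scaled (is_derive_std_pdf (y * rsqrt t)).
by apply: is_derive_eq; rewrite /heat3 /GRing.scale/=; ring.
Qed.

Lemma is_derive_scaled_time (f : R -> R) (df t y : R) : 0 < t ->
  is_derive (y * rsqrt t) 1 f df ->
  is_derive t 1 (fun t => f (y * rsqrt t)) (- (df * y * rsqrt t ^+ 3 / 2)).
Proof.
move=> t0 h; have h' := is_derive_rsqrt t0.
have hg : is_derive t 1 (fun t : R => y * rsqrt t) (- (y * rsqrt t ^+ 3 / 2)).
  by apply: is_derive_eq; rewrite /GRing.scale/=; ring.
by apply: is_derive_eq (@is_derive1_comp R f (fun t : R => y * rsqrt t) t _ _ h hg) _;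
  ring.
Qed.

Lemma is_derive_heat0_time (t y : R) : 0 < t ->
  is_derive t 1 (heat0^~ y) (heat2 t y / 2).
Proof.
move=> t0; have h := is_derive_scaled_time t0 (is_derive_std_cdf (y * rsqrt t)).
by apply: is_derive_eq; rewrite /heat2; ring.
Qed.

Lemma is_derive_heat2_time (t y : R) : 0 < t ->
  is_derive t 1 (heat2^~ y) (heat4 t y / 2).
Proof.
move=> t0; have h := is_derive_scaled_time t0 (is_derive_std_pdf (y * rsqrt t)).
have h' := is_derive_rsqrt t0.
by apply: is_derive_eq; rewrite /heat4 /GRing.scale/=; field.
Qed.
End Gauss.

(** * Taylor estimates *)

Section Taylor.
Context {R : realType}.

Lemma mean_value_bound (f df : R -> R) (K a b : R) : a <= b ->
  (forall x : R, a <= x <= b -> is_derive x 1 f (df x)) ->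
  (forall x : R, a <= x <= b -> `|df x| <= K) -> `|f b - f a| <= K * (b - a).
Proof.
move=> ab fdf dfK.
have [|//|x + ->] := @MVT_segment R f df a b ab.
- by move=> x; rewrite in_itv/= => /andP[ax xb]; apply: fdf; rewrite !ltW.
- apply: derivable_within_continuous => x; rewrite in_itv/= => xab.
  by have [] := fdf _ xab.
- rewrite in_itv/= => xab; rewrite normrM [X in _ * X <= _]ger0_norm ?subr_ge0//.
  by rewrite ler_wpM2r ?subr_ge0// dfK.
Qed.

Lemma mean_value_bound0 (f df : R -> R) (K d : R) :
  (forall x : R, `|x| <= `|d| -> is_derive x 1 f (df x)) ->
  (forall x : R, `|x| <= `|d| -> `|df x| <= K) -> `|f d - f 0| <= K * `|d|.
Proof.
move=> fdf dfK; have [d0|d0] := leP 0 d.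
  rewrite (ger0_norm d0) -[X in K * X]subr0; apply: (@mean_value_bound f df) => //.
  - by move=> x /andP[x0 xd]; apply: fdf; rewrite !ger0_norm.
  - by move=> x /andP[x0 xd]; apply: dfK; rewrite !ger0_norm.
rewrite (ltr0_norm d0) distrC -[X in K * X]add0r; apply: (@mean_value_bound f df) => //.
- exact: ltW.
- by move=> x /andP[x0 xd]; apply: fdf; rewrite !ler0_norm ?lerN2// ltW.
- by move=> x /andP[x0 xd]; apply: dfK; rewrite !ler0_norm ?lerN2// ltW.
Qed.

Lemma is_derive_shift (f : R -> R) (df y x : R) :
  is_derive (y + x) 1 f df -> is_derive x 1 (fun x => f (y + x)) df.
Proof.
move=> h; have hg : is_derive x 1 (fun x : R => y + x) 1.
  by have := @is_deriveD _ R R (cst y) id x 1 0 1 _ _; rewrite add0r; apply.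
have := @is_derive1_comp R f (fun x : R => y + x) x _ _ h hg.
by rewrite mulr1.
Qed.

Lemma lipschitz_bound (f df : R -> R) (K : R) :
  (forall x : R, is_derive x 1 f (df x)) -> (forall x : R, `|df x| <= K) ->
  forall y d, `|f (y + d) - f y| <= K * `|d|.
Proof.
move=> fdf dfK y d; rewrite -[X in _ - f X]addr0.
apply: (@mean_value_bound0 (fun d => f (y + d)) (fun d => df (y + d))) => //.
by move=> x _; exact: is_derive_shift.
Qed.

(** The derivative in d of a Taylor remainder of f is the remainder of one order less for f1, so
    each order follows from the previous one by the mean value theorem. The factorials are given
    up. *)
Lemma taylor1_bound (f f1 f2 : R -> R) (K : R) :
  (forall x : R, is_derive x 1 f (f1 x)) -> (forall x : R, is_derive x 1 f1 (f2 x)) ->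
  (forall x : R, `|f2 x| <= K) ->
  forall y d, `|f (y + d) - (f y + d * f1 y)| <= K * `|d| ^+ 2.
Proof.
move=> ff1 ff2 f2K y d.
have := @mean_value_bound0 (fun d => f (y + d) - d * f1 y)
  (fun d => f1 (y + d) - f1 y) (K * `|d|) d.
rewrite addr0 mul0r subr0 expr2 mulrA opprD addrA addrAC; apply.
- move=> x _; have h := is_derive_shift (ff1 (y + x)).
  by apply: is_derive_eq; rewrite /GRing.scale/=; ring.
- move=> x xd; apply: le_trans (lipschitz_bound ff2 f2K _ _) _.
  by rewrite ler_wpM2l// (le_trans _ (f2K 0)).
Qed.

Lemma taylor2_bound (f f1 f2 f3 : R -> R) (K : R) :
  (forall x : R, is_derive x 1 f (f1 x)) ->
  (forall x : R, is_derive x 1 f1 (f2 x)) ->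
  (forall x : R, is_derive x 1 f2 (f3 x)) -> (forall x, `|f3 x| <= K) ->
  forall y d,
  `|f (y + d) - (f y + d * f1 y + d ^+ 2 / 2 * f2 y)| <= K * `|d| ^+ 3.
Proof.
move=> ff1 ff2 ff3 f3K y d.
have := @mean_value_bound0 (fun d => f (y + d) - d * f1 y - d ^+ 2 / 2 * f2 y)
  (fun d => f1 (y + d) - (f1 y + d * f2 y)) (K * `|d| ^+ 2) d.
rewrite addr0 !mul0r expr0n/= !mul0r !subr0.
rewrite (_ : K * `|d| ^+ 2 * `|d| = K * `|d| ^+ 3); last ring.
rewrite (_ : f (y + d) - d * f1 y - d ^+ 2 / 2 * f2 y - f y =
  f (y + d) - (f y + d * f1 y + d ^+ 2 / 2 * f2 y)); last ring.
apply.
- move=> x _; have h := is_derive_shift (ff1 (y + x)).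
  by apply: is_derive_eq; rewrite /GRing.scale/=; field.
- move=> x xd; apply: le_trans (taylor1_bound ff2 ff3 f3K _ _) _.
  by rewrite ler_wpM2l ?lerXn2r ?nnegrE// (le_trans _ (f3K 0)).
Qed.

Lemma rsqrt_gt0 (t : R) : 0 < t -> 0 < rsqrt t.
Proof. by move=> t0; rewrite invr_gt0 sqrtr_gt0. Qed.

Lemma rsqrt_le (t0 t : R) : 0 < t0 -> t0 <= t -> rsqrt t <= rsqrt t0.
Proof.
move=> h0 ht; have h1 : 0 < t := lt_le_trans h0 ht.
by rewrite lef_pV2 ?posrE ?sqrtr_gt0 ?ler_sqrt ?(ltW h1).
Qed.

(** Squaring 1 + u <= exp u at u = z^2/4 gives exactly the factor exp(z^2/2) that the density
    cancels. The bound on q equals (4 + z^2)^2, enough for the cubic polynomials needed below. *)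
Lemma poly_std_pdf_bound (q z : R) : `|q| <= 16 * (1 + z ^+ 2 / 4) ^+ 2 ->
  `|q * std_pdf z| <= 16 * normal_peak 1.
Proof.
move=> hq; rewrite std_pdfE normrM [X in _ * X]ger0_norm; last first.
  by rewrite mulr_ge0// ?normal_peak_ge0// expR_ge0.
have h1 : 1 + z ^+ 2 / 4 <= expR (z ^+ 2 / 4) by exact: expR_ge1Dx.
have h2 : (1 + z ^+ 2 / 4) ^+ 2 <= expR (z ^+ 2 / 2).
  rewrite (_ : z ^+ 2 / 2 = 2%:R * (z ^+ 2 / 4)); last by field.
  rewrite expRM_natl lerXn2r// ?nnegrE ?expR_ge0//.
  by rewrite addr_ge0// mulr_ge0 ?sqr_ge0.
rewrite mulrCA [X in _ <= X]mulrC; apply: ler_wpM2l; first exact: normal_peak_ge0.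
rewrite expRN ler_pdivrMr ?expR_gt0//; apply: le_trans hq _.
by rewrite ler_wpM2l.
Qed.

(** With z = y [rsqrt t], the k-th derivative is [rsqrt t ^+ k] times, up to sign, the Hermite
    polynomial of degree k - 1 in z times the density; [rsqrt] is largest at t0. *)
Lemma heat_bounds (t0 : R) : 0 < t0 -> exists2 M : R, 0 < M &
  forall t y : R, t0 <= t ->
  [/\ `|heat1 t y| <= M, `|heat2 t y| <= M, `|heat3 t y| <= M & `|heat4 t y| <= M].
Proof.
move=> h0; exists ((1 + rsqrt t0) ^+ 4 * (16 * normal_peak 1)) => [|t y ht].
  by rewrite mulr_gt0 ?exprn_gt0 ?mulr_gt0 ?normal_peak_gt0 ?oner_eq0//
    addr_gt0// rsqrt_gt0.
have r0 : 0 < rsqrt t by apply: rsqrt_gt0; exact: lt_le_trans ht.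
have rle := rsqrt_le h0 ht.
have rX k : (k <= 4)%N -> `|rsqrt t ^+ k| <= (1 + rsqrt t0) ^+ 4.
  move=> k4; rewrite ger0_norm ?exprn_ge0 ?(ltW r0)//.
  apply: (@le_trans _ _ ((1 + rsqrt t0) ^+ k)).
    by rewrite lerXn2r ?nnegrE; lra.
  by apply: ler_weXn2l => //; lra.
pose z := y * rsqrt t.
have zq (q : R) k : (k <= 4)%N -> `|q| <= 16 * (1 + z ^+ 2 / 4) ^+ 2 ->
    `|rsqrt t ^+ k * (q * std_pdf z)| <= (1 + rsqrt t0) ^+ 4 * (16 * normal_peak 1).
  by move=> k4 hq; rewrite normrM ler_pM// ?rX// poly_std_pdf_bound.
have q1 : `|1 : R| <= 16 * (1 + z ^+ 2 / 4) ^+ 2.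
  by rewrite normr1; nra.
have q2 : `|- z| <= 16 * (1 + z ^+ 2 / 4) ^+ 2.
  by rewrite ler_norml; nra.
have q3 : `|z ^+ 2 - 1| <= 16 * (1 + z ^+ 2 / 4) ^+ 2.
  by rewrite ler_norml; nra.
have q4 : `|3 * z - z ^+ 3| <= 16 * (1 + z ^+ 2 / 4) ^+ 2.
  by rewrite ler_norml; nra.
split.
- by have := zq _ 1%N isT q1; rewrite /heat1 -/z expr1 mul1r.
- have := zq _ 2%N isT q2; rewrite /heat2 -/z.
  by congr (`|_| <= _); rewrite /z; ring.
- have := zq _ 3%N isT q3; rewrite /heat3 -/z.
  by congr (`|_| <= _); rewrite /z; ring.
- have := zq _ 4%N isT q4; rewrite /heat4 -/z.
  by congr (`|_| <= _); rewrite /z; ring.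
Qed.

End Taylor.

(** * One step of the walk *)

Section Step.
Context {R : realType}.

Lemma heat0_lipschitz (M t : R) :
  (forall y, `|heat1 t y| <= M) ->
  forall y d, `|heat0 t (y + d) - heat0 t y| <= M * `|d|.
Proof. by move=> hM; apply: lipschitz_bound hM => x; exact: is_derive_heat0. Qed.

Lemma heat2_lipschitz (M t : R) :
  (forall y, `|heat3 t y| <= M) ->
  forall y d, `|heat2 t (y + d) - heat2 t y| <= M * `|d|.
Proof. by move=> hM; apply: lipschitz_bound hM => x; exact: is_derive_heat2. Qed.

Lemma heat0_taylor (M t : R) :
  (forall y, `|heat3 t y| <= M) -> forall y d,
  `|heat0 t (y + d) - (heat0 t y + d * heat1 t y + d ^+ 2 / 2 * heat2 t y)|
    <= M * `|d| ^+ 3.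
Proof.
move=> hM; apply: taylor2_bound hM => x.
- exact: is_derive_heat0.
- exact: is_derive_heat1.
- exact: is_derive_heat2.
Qed.

Lemma heat2_time_lipschitz (M t y h : R) : 0 < t -> 0 <= h ->
  (forall s, t <= s -> `|heat4 s y| <= M) ->
  `|heat2 (t + h) y - heat2 t y| <= M * h.
Proof.
move=> t0 h0 hM; have M0 : 0 <= M by rewrite (le_trans _ (hM _ (lexx _))).
have := @mean_value_bound R (heat2^~ y) (fun s => heat4 s y / 2) M t (t + h).
rewrite [t + h - t]addrAC subrr add0r; apply; first by rewrite lerDl.
- move=> s /andP[ts _]; apply: is_derive_heat2_time.
  exact: lt_le_trans ts.
- move=> s /andP[ts _]; rewrite normrM (@ger0_norm _ 2^-1)//.
  by have := hM _ ts; lra.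
Qed.

(** By the heat equation, advancing time by h has the same leading effect, h/2 times [heat2], as
    averaging over a centred space increment of variance h. *)
Lemma heat0_time_taylor (M t y h : R) : 0 < t -> 0 <= h ->
  (forall s, t <= s -> `|heat4 s y| <= M) ->
  `|heat0 (t + h) y - (heat0 t y + h / 2 * heat2 t y)| <= M * h ^+ 2.
Proof.
move=> t0 h0 hM; have M0 : 0 <= M by rewrite (le_trans _ (hM _ (lexx _))).
have := @mean_value_bound R (fun s => heat0 s y - (s - t) / 2 * heat2 t y)
  (fun s => (heat2 s y - heat2 t y) / 2) (M * h) t (t + h).
rewrite [t + h - t]addrAC !subrr !mul0r subr0 ?add0r.
rewrite (_ : M * h * h = M * h ^+ 2); last ring.
rewrite opprD addrA addrAC; apply; first by rewrite lerDl.
- move=> s /andP[ts _]; have hs : 0 < s by exact: lt_le_trans ts.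
  have := is_derive_heat0_time y hs => hd.
  by apply: is_derive_eq; rewrite /GRing.scale/=; field.
- move=> s /andP[ts sth]; rewrite normrM (@ger0_norm _ 2^-1)//.
  have st : 0 <= s - t by rewrite subr_ge0.
  have := heat2_time_lipschitz t0 st hM; rewrite [t + _]addrC subrK => h1.
  have : M * (s - t) <= M * h by rewrite ler_wpM2l//; lra.
  have : 0 <= `|heat2 s y - heat2 t y| by [].
  lra.
Qed.

(* Expectation of [g] at the next step, given the first step [x] and the last
   step [y]. *)
Definition erw_step (p x : R) (g : R -> R) (y : R) : R :=
  p / 2 * (g x + g y) + (1 - p) / 2 * (g (- x) + g (- y)).

Lemma erw_step_close (p x y e : R) (f g : R -> R) :
  0 < p < 1 -> x ^+ 2 = 1 -> y ^+ 2 = 1 ->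
  (forall z, z ^+ 2 = 1 -> `|f z - g z| <= e) ->
  `|erw_step p x f y - erw_step p x g y| <= e.
Proof.
move=> /andP[p0 p1] x1 y1 fg.
have x2 : (- x) ^+ 2 = 1 by rewrite sqrrN.
have y2 : (- y) ^+ 2 = 1 by rewrite sqrrN.
move: (fg _ x1) (fg _ y1) (fg _ x2) (fg _ y2); rewrite /erw_step.
rewrite !ler_norml => /andP[? ?] /andP[? ?] /andP[? ?] /andP[? ?].
by apply/andP; split; nra.
Qed.

Definition erw_drift (p : R) : R := (2 * p - 1) / (3 - 2 * p).

(** The conditional variance of the martingale increment, (1+m)^2 (1 - r^2 (x+y)^2), averaged over
    the stationary law of y, whose mean is m x. *)
Definition erw_variance (p : R) : R :=
  (1 - erw_drift p ^+ 2) * (1 + 2 * erw_drift p).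

(** The lower bound keeps 1 + 2m, and with it the limiting variance, positive. *)
Lemma erw_drift_bound (p : R) : 0 < p < 1 -> - (1 / 3) < erw_drift p < 1.
Proof.
move=> /andP[p0 p1]; have h : 0 < 3 - 2 * p by lra.
by rewrite /erw_drift ltr_pdivlMr// ltr_pdivrMr//; apply/andP; split; lra.
Qed.

(** D has mean zero, so v1 disappears, and half its second moment is c^2 ([erw_variance p] / 2 - m^2
    x(y - m x)). The corrector coefficient a must satisfy a - r a = m^2; since 1 - r = 1/(1+m), this
    gives a = m^2 (1+m). The identity is checked on the four sign pairs. *)
Lemma erw_step_quadratic (p x y c v0 v1 v2 : R) :
  0 < p < 1 -> x ^+ 2 = 1 -> y ^+ 2 = 1 ->
  let m := erw_drift p in
  erw_step p x (fun z =>
    let D := - (c * ((1 + m) * (z - m * x) - m * (y - m * x))) in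
    v0 + D * v1 + D ^+ 2 / 2 * v2
      - m ^+ 2 * (1 + m) * c ^+ 2 * (x * (z - m * x)) * v2) y =
  v0 + erw_variance p * c ^+ 2 / 2 * v2
    - m ^+ 2 * (1 + m) * c ^+ 2 * (x * (y - m * x)) * v2.
Proof.
move=> /andP[p0 p1] /eqP + /eqP + m; have h : 3 - 2 * p != 0 by rewrite gt_eqF//; lra.
rewrite !sqrf_eq1 => /orP[]/eqP-> /orP[]/eqP->;
rewrite /erw_step /= /erw_variance /m /erw_drift; by field.
Qed.

(* Here [z] stands for a threshold minus the rescaled martingale; the second term
   compensates the dependence of the conditional variance of the next increment
   on the current step [y]. *)
Definition corrected_heat (p c x t y z : R) : R :=
  let m := erw_drift p in
  heat0 t z - m ^+ 2 * (1 + m) * c ^+ 2 * (x * (y - m * x)) * heat2 t z.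


Lemma sgn_bound (z : R) : z ^+ 2 = 1 -> -1 <= z <= 1.
Proof. by move=> /eqP; rewrite sqrf_eq1 => /orP[]/eqP->; lra. Qed.

Lemma erw_corrector_bound (p c x y : R) :
  0 < p < 1 -> x ^+ 2 = 1 -> y ^+ 2 = 1 ->
  `|erw_drift p ^+ 2 * (1 + erw_drift p) * c ^+ 2 * (x * (y - erw_drift p * x))|
    <= 4 * c ^+ 2.
Proof.
move=> hp x1 y1; pose m := erw_drift p; rewrite -/m.
have /andP[m0 m1] := erw_drift_bound hp.
rewrite -/m in m0 m1.
have -> : m ^+ 2 * (1 + m) * c ^+ 2 * (x * (y - m * x)) =
  m ^+ 2 * (1 + m) * (x * (y - m * x)) * c ^+ 2 by ring.
rewrite normrM [X in _ * X]ger0_norm ?sqr_ge0//.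
apply: ler_wpM2r; first exact: sqr_ge0.
rewrite normrM (_ : 4 = 2 * 2 :> R); last ring.
apply: ler_pM => //.
  by rewrite ler_norml; apply/andP; split; nra.
rewrite (_ : x * (y - m * x) = x * y - m); last by rewrite mulrBr mulrCA -expr2 x1 mulr1.
move: x1 y1 => /eqP + /eqP.
by rewrite !sqrf_eq1 => /orP[]/eqP-> /orP[]/eqP->; rewrite ler_norml; lra.
Qed.

Lemma erw_increment_bound (p c x y z : R) :
  0 < p < 1 -> 0 < c -> x ^+ 2 = 1 -> y ^+ 2 = 1 -> z ^+ 2 = 1 ->
  `|- (c * ((1 + erw_drift p) * (z - erw_drift p * x)
    - erw_drift p * (y - erw_drift p * x)))| <= 6 * c.
Proof.
move=> hp c0 x1 y1 z1; pose m := erw_drift p; rewrite -/m.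
have /andP[m0 m1] := erw_drift_bound hp.
rewrite -/m in m0 m1.
rewrite normrN normrM gtr0_norm// mulrC ler_wpM2r ?(ltW c0)//.
move: x1 y1 z1 => /eqP + /eqP + /eqP.
by rewrite !sqrf_eq1 => /orP[]/eqP-> /orP[]/eqP-> /orP[]/eqP->;
  rewrite ler_norml; apply/andP; split; nra.
Qed.

Lemma erw_variance_bound (p : R) : 0 < p < 1 -> 0 < erw_variance p <= 3.
Proof.
move=> hp; have /andP[m0 m1] := erw_drift_bound hp.
by rewrite /erw_variance; apply/andP; split; nra.
Qed.

(** Time measures the variance still to come: averaging over the next step at time t matches the
    value before that step at time t + [erw_variance p] c^2. *)
Lemma corrected_heat_step (p t0 : R) : 0 < p < 1 -> 0 < t0 ->
  exists2 C : R, 0 < C & forall c t x y z : R, 0 < c <= 1 -> t0 <= t ->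
  x ^+ 2 = 1 -> y ^+ 2 = 1 ->
  `|erw_step p x (fun y' => corrected_heat p c x t y'
       (z - c * ((1 + erw_drift p) * (y' - erw_drift p * x)
         - erw_drift p * (y - erw_drift p * x)))) y
    - corrected_heat p c x (t + erw_variance p * c ^+ 2) y z| <= C * c ^+ 3.
Proof.
move=> hp ht0; have [M M0 hM] := heat_bounds ht0.
(* The space expansion costs 240 = 6^3 + 4 * 6 and the time expansion 21 = 3^2 + 4 * 3, where 6c
   bounds the increment, 4c^2 the corrector and 3c^2 the time increment. *)
exists (300 * M) => [|c t x y z /andP[c0 c1] ht x1 y1]; first by rewrite mulr_gt0.
pose m := erw_drift p; rewrite -/m.
have H k y' : t0 <= k -> `|heat3 k y'| <= M by case/(hM k y').
have H4 k y' : t0 <= k -> `|heat4 k y'| <= M by case/(hM k y').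
have t_gt0 : 0 < t by exact: lt_le_trans ht.
have /andP[s0 s3] := erw_variance_bound hp.
pose h := erw_variance p * c ^+ 2.
have h0 : 0 <= h by rewrite mulr_ge0 ?sqr_ge0// ltW.
have h3 : h <= 3 * c ^+ 2 by rewrite ler_wpM2r ?sqr_ge0.
have c3 : c ^+ 2 * c ^+ 2 <= c ^+ 3.
  by rewrite -exprD; apply: ler_wiXn2l => //; exact: ltW.
have Mc3 : 0 <= M * c ^+ 3 by rewrite mulr_ge0 ?exprn_ge0// ltW.
have step := @erw_step_close p x y (240 * (M * c ^+ 3)) _ _ hp x1 y1.
(* Second-order expansion in D, with the [heat2] factor of the corrector frozen at z: as the
   corrector is already of order c^2, this costs only order c^3. *)
pose Q z' := let D := - (c * ((1 + m) * (z' - m * x) - m * (y - m * x))) in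
    heat0 t z + D * heat1 t z + D ^+ 2 / 2 * heat2 t z
      - m ^+ 2 * (1 + m) * c ^+ 2 * (x * (z' - m * x)) * heat2 t z.
have {step} := step (fun y' => corrected_heat p c x t y'
  (z - c * ((1 + m) * (y' - m * x) - m * (y - m * x)))) Q.
rewrite (@erw_step_quadratic p x y c _ _ _ hp x1 y1) -/m => main.
have {}main := main _.
rewrite -/h.
have timed : `|corrected_heat p c x (t + h) y z -
   (heat0 t z + h / 2 * heat2 t z
    - m ^+ 2 * (1 + m) * c ^+ 2 * (x * (y - m * x)) * heat2 t z)| <=
    21 * (M * c ^+ 3).
  have e1 := heat0_time_taylor t_gt0 h0 (fun s ts => H4 s z (le_trans ht ts)).
  have e2 := heat2_time_lipschitz t_gt0 h0 (fun s ts => H4 s z (le_trans ht ts)).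
  have e3 := erw_corrector_bound c hp x1 y1; rewrite -/m in e3.
  rewrite /corrected_heat -/m; set k := m ^+ 2 * _ * _ * _ in e3 *.
  have -> : heat0 (t + h) z - k * heat2 (t + h) z -
      (heat0 t z + h / 2 * heat2 t z - k * heat2 t z) =
    (heat0 (t + h) z - (heat0 t z + h / 2 * heat2 t z)) -
      k * (heat2 (t + h) z - heat2 t z) by ring.
  apply: le_trans (ler_normB _ _) _; rewrite normrM.
  have e4 : `|k| * `|heat2 (t + h) z - heat2 t z| <= 4 * c ^+ 2 * (M * (3 * c ^+ 2)).
    by apply: ler_pM => //; apply: le_trans e2 _; rewrite ler_wpM2l// ltW.
  have e5 : M * h ^+ 2 <= M * (3 * c ^+ 2) ^+ 2.
    rewrite ler_wpM2l ?(ltW M0)// lerXn2r// nnegrE mulr_ge0//; exact: sqr_ge0.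
  have e6 : M * (c ^+ 2 * c ^+ 2) <= M * c ^+ 3 by rewrite ler_wpM2l// ltW.
  have -> : 21 * (M * c ^+ 3) = 9 * (M * c ^+ 3) + 12 * (M * c ^+ 3) by ring.
  apply: lerD; first by apply: le_trans e1 _; apply: le_trans e5 _; nra.
  by apply: le_trans e4 _; nra.
have spaced : forall z', z' ^+ 2 = 1 ->
    `|corrected_heat p c x t z'
       (z - c * ((1 + m) * (z' - m * x) - m * (y - m * x))) - Q z'| <= 240 * (M * c ^+ 3).
  move=> z' z1; have dD := erw_increment_bound hp c0 x1 y1 z1; rewrite -/m in dD.
  rewrite /corrected_heat /Q -/m; set D := - (c * _) in dD *.
  have e3 := erw_corrector_bound c hp x1 z1; rewrite -/m in e3.
  set k := m ^+ 2 * _ * _ * _ in e3 *.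
  have e1 := heat0_taylor (fun y => H t y ht) z D.
  have e2 := heat2_lipschitz (fun y => H t y ht) z D.
  have -> : heat0 t (z + D) - k * heat2 t (z + D) -
      (heat0 t z + D * heat1 t z + D ^+ 2 / 2 * heat2 t z - k * heat2 t z) =
    (heat0 t (z + D) - (heat0 t z + D * heat1 t z + D ^+ 2 / 2 * heat2 t z)) -
      k * (heat2 t (z + D) - heat2 t z) by ring.
  apply: le_trans (ler_normB _ _) _; rewrite normrM.
  have e4 : `|k| * `|heat2 t (z + D) - heat2 t z| <= 4 * c ^+ 2 * (M * (6 * c)).
    by apply: ler_pM => //; apply: le_trans e2 _; rewrite ler_wpM2l// ltW.
  have e5 : M * `|D| ^+ 3 <= M * (6 * c) ^+ 3.
    by rewrite ler_wpM2l ?(ltW M0)// lerXn2r// nnegrE mulr_ge0// ltW.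
  have -> : 240 * (M * c ^+ 3) = M * (6 * c) ^+ 3 + 4 * c ^+ 2 * (M * (6 * c)) by ring.
  apply: lerD => //; exact: le_trans e5.
move: {main}(main spaced) timed; rewrite -/h !ler_norml.
by move=> /andP[? ?] /andP[? ?]; apply/andP; split; lra.
Qed.

End Step.

(** * Many steps *)

Section Iter.
Context {R : realType}.

(* Expectation of [f] at the last step and position, [n] steps after being at
   position [s] with last step [y]. *)
Fixpoint erw_iter (p x : R) (n : nat) (f : R -> R -> R) (y s : R) : R :=
  if n is n'.+1 then erw_step p x (fun z => erw_iter p x n' f z (s + z)) y
  else f y s.

Lemma erw_step_le (p x y e : R) (f g : R -> R) :
  0 < p < 1 -> x ^+ 2 = 1 -> y ^+ 2 = 1 ->
  (forall z, z ^+ 2 = 1 -> f z <= g z + e) ->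
  erw_step p x f y <= erw_step p x g y + e.
Proof.
move=> /andP[p0 p1] x1 y1 fg.
have x2 : (- x) ^+ 2 = 1 by rewrite sqrrN.
have y2 : (- y) ^+ 2 = 1 by rewrite sqrrN.
by move: (fg _ x1) (fg _ y1) (fg _ x2) (fg _ y2); rewrite /erw_step; nra.
Qed.

Lemma erw_iter_le (p x e : R) (f g : R -> R -> R) (n : nat) :
  0 < p < 1 -> x ^+ 2 = 1 ->
  (forall y s, y ^+ 2 = 1 -> f y s <= g y s + e) ->
  forall y s, y ^+ 2 = 1 -> erw_iter p x n f y s <= erw_iter p x n g y s + e.
Proof.
move=> hp x1 fg; elim: n => [//|n IH] y s y1 /=.
by apply: erw_step_le => // z z1; exact: IH.
Qed.

(** [W k] approximates the expectation with k steps to go. Since [erw_step] is an average, it does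
    not enlarge earlier errors, so they add up. *)
Lemma erw_iter_approx (p x e : R) (W : nat -> R -> R -> R) (n : nat) :
  0 < p < 1 -> x ^+ 2 = 1 ->
  (forall k y s, y ^+ 2 = 1 ->
    `|erw_step p x (fun z => W k z (s + z)) y - W k.+1 y s| <= e) ->
  forall y s, y ^+ 2 = 1 -> `|erw_iter p x n (W 0%N) y s - W n y s| <= n%:R * e.
Proof.
move=> hp x1 hW; elim: n => [|n IH] y s y1 /=; first by rewrite subrr normr0 mul0r.
have := @erw_step_close _ p x y (n%:R * e) (fun z => erw_iter p x n (W 0%N) z (s + z))
  (fun z => W n z (s + z)) hp x1 y1 (fun z z1 => IH z (s + z) z1).
move: (hW n y s y1); rewrite -natr1 !ler_norml.
by move=> /andP[? ?] /andP[? ?]; apply/andP; split; lra.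
Qed.

Lemma erw_iter_heat (p t0 : R) : 0 < p < 1 -> 0 < t0 ->
  exists2 C : R, 0 < C & forall (n : nat) (c b x y s : R), 0 < c <= 1 ->
  n.+2%:R * (erw_variance p * c ^+ 2) = 1 ->
  x ^+ 2 = 1 -> y ^+ 2 = 1 -> `|s| <= 2 ->
  `|erw_iter p x n
     (fun _ s => heat0 t0 (b - c * (s - erw_drift p * n.+2%:R * x))) y s
    - heat0 (t0 + 1) b| <= C * c.
Proof.
move=> hp ht0; have [M M0 hM] := heat_bounds ht0.
have [K K0 hK] := corrected_heat_step hp ht0.
have /andP[s0 s3] := erw_variance_bound hp.
have /andP[m0 m1] := erw_drift_bound hp.
set m := erw_drift p in m0 m1 hK *.
(* 55 = 6 + 49 covers the last and the initial time; the other term sums the n errors K c^3, as n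
   c^2 is at most the inverse of [erw_variance p]. *)
exists (55 * M + K / erw_variance p) => [|n c b x y s /andP[c0 c1] nc x1 y1 s2].
  by apply: addr_gt0; [apply: mulr_gt0|apply: divr_gt0].
have /andP[xl xr] := sgn_bound x1.
pose h := erw_variance p * c ^+ 2.
have h0 : 0 < h by rewrite mulr_gt0// exprn_gt0.
have cc : c ^+ 2 <= c by rewrite expr2 ler_piMr// ltW.
have h3 : h <= 3 * c ^+ 2 by rewrite ler_wpM2r ?sqr_ge0.
pose N : R := n.+2%:R.
(* With k steps to go the walk has made N - k steps, so the space argument is b minus c times the
   martingale at time N - k. *)
pose W k y s := corrected_heat p c x (t0 + k%:R * h) y
  (b - c * (s - m * (N - k%:R) * x + m * (y - m * x))).
have stepW k y' s' : y' ^+ 2 = 1 ->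
    `|erw_step p x (fun z => W k z (s' + z)) y' - W k.+1 y' s'| <= K * c ^+ 3.
  move=> y1'; have tk : t0 <= t0 + k%:R * h by rewrite lerDl mulr_ge0// ltW.
  have c01 : 0 < c <= 1 by rewrite c0.
  have kS : k.+1%:R = k%:R + 1 :> R by rewrite natr1.
  set z0 := b - c * (s' - m * (N - k.+1%:R) * x + m * (y' - m * x)).
  have stepz z : b - c * (s' + z - m * (N - k%:R) * x + m * (z - m * x)) =
      z0 - c * ((1 + m) * (z - m * x) - m * (y' - m * x)).
    by rewrite /z0 kS; ring.
  have := hK c (t0 + k%:R * h) x y' z0 c01 tk x1 y1'.
  have -> : t0 + k%:R * h + erw_variance p * c ^+ 2 = t0 + k.+1%:R * h.
    by rewrite kS mulrDl mul1r addrA.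
  rewrite /W; under [X in erw_step p x X y' - _]boolp.eq_fun => z do rewrite -stepz.
  exact.
have := @erw_iter_approx p x _ W n hp x1 stepW y s y1.
set f := (fun _ s => heat0 t0 _).
(* At the end, dropping the martingale's boundary term m(y' - m x) costs 2 M c and dropping the
   corrector 4 M c. *)
have fW y' s' : y' ^+ 2 = 1 -> `|f y' s' - W 0%N y' s'| <= 6 * M * c.
  move=> y1'; rewrite /f /W mul0r addr0 subr0 -/N /corrected_heat -/m.
  have /andP[yl yr] := sgn_bound y1'.
  have e3 := erw_corrector_bound c hp x1 y1'; rewrite -/m in e3.
  set k := m ^+ 2 * _ * _ * _ in e3 *.
  set z := b - c * (s' - m * N * x + m * (y' - m * x)).
  have h2 : `|heat2 t0 z| <= M by case: (hM t0 z (lexx _)).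
  have := @heat0_lipschitz _ M t0 _ z (c * (m * (y' - m * x))).
  rewrite (_ : z + c * (m * (y' - m * x)) = b - c * (s' - m * N * x)); last by rewrite /z; ring.
  move=> /(_ (fun y'' => let: And4 h _ _ _ := hM t0 y'' (lexx t0) in h)).
  have -> : `|c * (m * (y' - m * x))| = `|m * (y' - m * x)| * c.
    by rewrite normrM gtr0_norm// mulrC.
  have h4 : `|m * (y' - m * x)| <= 2 by rewrite ler_norml; apply/andP; split; nra.
  move=> h5.
  rewrite (_ : _ - (_ - _) = heat0 t0 (b - c * (s' - m * N * x))
    - heat0 t0 z + k * heat2 t0 z); last ring.
  apply: le_trans (ler_normD _ _) _.
  rewrite (_ : 6 * M * c = M * (2 * c) + 4 * c * M); last ring.
  apply: lerD; first by apply: le_trans h5 _; rewrite ler_wpM2l ?(ltW M0)// ler_wpM2r// ltW.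
  rewrite normrM ler_pM//; apply: le_trans e3 _; lra.
have itup := @erw_iter_le p x (6 * M * c) f (W 0%N) n hp x1 _ y s y1.
have itdown := @erw_iter_le p x (6 * M * c) (W 0%N) f n hp x1 _ y s y1.
have {}itup : erw_iter p x n f y s <= erw_iter p x n (W 0%N) y s + 6 * M * c.
  by apply: itup => y' s' /(fW _ s'); rewrite ler_norml => /andP[? ?]; lra.
have {}itdown : erw_iter p x n (W 0%N) y s <= erw_iter p x n f y s + 6 * M * c.
  by apply: itdown => y' s' /(fW _ s'); rewrite ler_norml => /andP[? ?]; lra.
(* Two steps are already made, so the clock shows t0 + 1 - 2h and the martingale is at most 6. The
   terms are 6 for this displacement, 36 and 3 for the remainder and the main part of the time shift
   2h, and 4 for the corrector. *)
have start : `|W n y s - heat0 (t0 + 1) b| <= 49 * M * c.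
  have tN : t0 + n%:R * h + 2 * h = t0 + 1.
    rewrite -addrA -mulrDl; congr (_ + _).
    by rewrite -[RHS]nc -/h; congr (_ * _); rewrite -natrD addn2.
  rewrite /W /corrected_heat -/m.
  have e3 := erw_corrector_bound c hp x1 y1; rewrite -/m in e3.
  set k := m ^+ 2 * _ * _ * _ in e3 *.
  have N2 : N - n%:R = 2.
    by rewrite /N -addn2 natrD addrAC subrr add0r.
  rewrite N2; set D := s - _ + _.
  have D6 : `|D| <= 6.
    have /andP[yl yr] := sgn_bound y1.
    move: s2; rewrite /D !ler_norml => /andP[sl sr].
    have ? : -2 <= m * (y - m * x) <= 2 by apply/andP; split; nra.
    have ? : -2 <= m * 2 * x <= 2 by apply/andP; split; nra.
    by apply/andP; split; lra.
  pose t := t0 + n%:R * h; rewrite -/t in tN *.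
  have tt : t0 <= t by rewrite lerDl mulr_ge0// ltW.
  have tpos : 0 < t by exact: lt_le_trans tt.
  have h2 z : `|heat2 t z| <= M by case: (hM t z tt).
  have d1 := @heat0_lipschitz _ M t
    (fun y => let: And4 h _ _ _ := hM t y tt in h) b (- (c * D)).
  have hh0 : 0 <= 2 * h by rewrite mulr_ge0// ltW.
  have d2 := @heat0_time_taylor _ M t b (2 * h) tpos hh0
    (fun u tu => let: And4 _ _ _ h := hM u b (le_trans tt tu) in h).
  rewrite tN in d2.
  rewrite (_ : _ - _ - _ = (heat0 t (b - c * D) - heat0 t b)
    - (heat0 (t0 + 1) b - (heat0 t b + 2 * h / 2 * heat2 t b))
    - h * heat2 t b - k * heat2 t (b - c * D)); last by field.
  have c4 : c ^+ 2 * c ^+ 2 <= c by have := sqr_ge0 c; nra.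
  have b1 : `|heat0 t (b - c * D) - heat0 t b| <= 6 * M * c.
    apply: le_trans d1 _; rewrite normrN normrM gtr0_norm//.
    by rewrite (_ : 6 * M * c = M * (c * 6)); [rewrite !ler_wpM2l// ltW|ring].
  have b2 : M * (2 * h) ^+ 2 <= 36 * M * c.
    rewrite (_ : 36 * M * c = M * (36 * c)); last ring.
    by rewrite ler_wpM2l ?(ltW M0)//; have := sqr_ge0 c; nra.
  have b3 : `|h * heat2 t b| <= 3 * M * c.
    rewrite normrM gtr0_norm// (_ : 3 * M * c = (3 * c) * M); last ring.
    by rewrite ler_pM ?(ltW h0)//; lra.
  have b4 : `|k * heat2 t (b - c * D)| <= 4 * M * c.
    rewrite normrM (_ : 4 * M * c = (4 * c) * M); last ring.
    by rewrite ler_pM//; lra.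
  have {d2}b2 := le_trans d2 b2.
  rewrite (_ : 49 * M * c =
    6 * M * c + 36 * M * c + 3 * M * c + 4 * M * c); last by ring.
  by do 3 (apply: le_trans (ler_normB _ _) _; apply: lerD => //).
have nK : n%:R * (K * c ^+ 3) <= K / erw_variance p * c.
  rewrite (_ : n%:R * (K * c ^+ 3) = K * c * (n%:R * c ^+ 2)); last ring.
  rewrite (_ : K / erw_variance p * c = K * c * (erw_variance p)^-1); last by ring.
  rewrite ler_wpM2l ?mulr_ge0 ?(ltW K0) ?(ltW c0)//.
  rewrite -[X in _ <= X]mul1r ler_pdivlMr//.
  rewrite (_ : n%:R * c ^+ 2 * erw_variance p = n%:R * h); last by rewrite /h; ring.
  by rewrite -[X in _ <= X]nc ler_wpM2r ?(ltW h0)// ler_nat -addn2 leq_addr.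
move: start; rewrite !ler_norml => /andP[? ?] /andP[? ?].
by apply/andP; split; lra.
Qed.

End Iter.

(** * Removal of the smoothing *)

Section Limit.
Context {R : realType}.

Lemma std_cdf_tails (e : R) : 0 < e ->
  exists2 L : R, 0 < L & 1 - std_cdf L <= e /\ std_cdf (- L) <= e.
Proof.
move=> e0.
have h1 : \forall x \near +oo, `|1 - std_cdf x| <= e.
  by move/cvgrPdist_le : (@cvg_std_cdfy R); apply.
have h2 : \forall x \near -oo, `|0 - std_cdf x| <= e.
  by move/cvgrPdist_le : (@cvg_std_cdfNy R); apply.
case: h1 => A [_ hA]; case: h2 => B [_ hB].
pose L := 1 + `|A| + `|B|.
have nA := ler_norm A; have nB := ler_norm (- B); rewrite normrN in nB.
have pA : 0 <= `|A| by []. have pB : 0 <= `|B| by [].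
exists L; first by rewrite /L; lra.
split.
  by apply: le_trans (hA L _); [exact: ler_norm|rewrite /L; lra].
apply: le_trans (hB (- L) _); last by rewrite /L; lra.
by rewrite sub0r normrN; exact: ler_norm.
Qed.

Lemma rsqrt_invX2 (L : R) : 0 < L -> rsqrt (L ^- 2) = L.
Proof. by move=> L0; rewrite /rsqrt sqrtrV ?sqr_ge0// sqrtr_sqr gtr0_norm// invrK. Qed.

Lemma heat0_1 (b : R) : heat0 1 b = std_cdf b.
Proof. by rewrite /heat0 /rsqrt sqrtr1 invr1 mulr1. Qed.

(** Shifting the threshold by d, at least L standard deviations of the smoothing, turns the smoothed
    indicator into a lower or an upper bound of the sharp one up to a Gaussian tail. *)
Lemma heat0_indicator (t d b z e L : R) : L <= d * rsqrt t -> 0 < t ->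
  1 - std_cdf L <= e -> std_cdf (- L) <= e ->
  heat0 t (b - d - z) <= (z <= b)%R%:R + e /\
  (z <= b)%R%:R <= heat0 t (b + d - z) + e.
Proof.
move=> Ld t0 tail1 tail2; have r0 : 0 <= rsqrt t by rewrite ltW// rsqrt_gt0.
have e0 : 0 <= e := le_trans (std_cdf_ge0 _) tail2.
have [zb|bz] := leP z b; rewrite ?add0r; split.
- by rewrite -[leLHS]addr0 lerD// std_cdf_le1.
- rewrite -lerBlDr; have : 1 - e <= std_cdf L by rewrite lerBlDr addrC -lerBlDr.
  move=> /le_trans; apply; apply: std_cdf_nondecreasing.
  by apply: le_trans Ld _; rewrite ler_wpM2r//; lra.
- apply: le_trans tail2; apply: std_cdf_nondecreasing.
  rewrite -lerN2 opprK -mulNr; apply: le_trans Ld _.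
  by rewrite ler_wpM2r//; lra.
- by rewrite addr_ge0// std_cdf_ge0.
Qed.

Lemma small_time (L d eta : R) : 0 < L -> 0 < d -> 0 < eta ->
  exists2 t : R, 0 < t <= 1 & t <= eta /\ L <= d * rsqrt t.
Proof.
move=> L0 d0 eta0.
have Ld : 0 < L / d by rewrite divr_gt0.
have eta1 : 0 < eta^-1 by rewrite invr_gt0.
have [K [K1 Keta KL]] : exists K, [/\ 1 <= K, eta^-1 <= K & L / d <= K].
  by exists (1 + L / d + eta^-1); split; lra.
have K0 : 0 < K := lt_le_trans ltr01 K1.
(* For this t, [rsqrt t] is K, so all requirements become lower bounds on K; K >= 1 also gives K^-2
   <= K^-1 <= eta. *)
exists (K ^- 2).
  by rewrite invr_gt0 exprn_gt0// invf_le1 ?exprn_gt0// exprn_ege1.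
split; last by rewrite rsqrt_invX2// mulrC -ler_pdivrMr.
rewrite -(invrK eta) lef_pV2 ?posrE ?exprn_gt0//.
by apply: le_trans Keta _; rewrite expr2 ler_peMl// ltW.
Qed.

Lemma heat0_near1 (M a t : R) : 0 < t <= 1 ->
  (forall s y, 1 <= s -> `|heat2 s y| <= M /\ `|heat4 s y| <= M) ->
  `|heat0 (t + 1) a - heat0 1 a| <= 2 * (M * t).
Proof.
move=> /andP[t0 t1] hM; rewrite [t + 1]addrC.
have [h2 _] := hM 1 a (lexx _).
have M0 : 0 <= M := le_trans (normr_ge0 _) h2.
have := heat0_time_taylor ltr01 (ltW t0) (fun u tu => proj2 (hM u a tu)).
have : `|t / 2 * heat2 1 a| <= M * t.
  rewrite normrM ger0_norm; last by rewrite mulr_ge0// ltW.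
  by rewrite [leRHS]mulrC ler_pM//; lra.
have Mt : M * t ^+ 2 <= M * t by rewrite expr2 mulrA ler_piMr// mulr_ge0// ltW.
set A := heat0 (1 + t) a; set B := heat0 1 a; set S := t / 2 * _.
move=> hS hA; rewrite (_ : A - B = (A - (B + S)) + S); last by ring.
rewrite mulr_natl mulr2n; apply: le_trans (ler_normD _ _) _.
by apply: lerD => //; apply: le_trans hA _.
Qed.

Lemma dist_chain (e u v v' w : R) : `|u - v| <= e -> `|v - v'| <= e ->
  `|v' - w| <= e -> - (3 * e) <= u - w <= 3 * e.
Proof.
rewrite !ler_norml => /andP[? ?] /andP[? ?] /andP[? ?].
by apply/andP; split; lra.
Qed.

Lemma erw_iter_cvg (p b e : R) : 0 < p < 1 -> 0 < e ->
  exists2 c0 : R, 0 < c0 & forall (n : nat) (c x y s : R), 0 < c <= c0 ->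
  n.+2%:R * (erw_variance p * c ^+ 2) = 1 ->
  x ^+ 2 = 1 -> y ^+ 2 = 1 -> `|s| <= 2 ->
  `|erw_iter p x n
     (fun _ s => (c * (s - erw_drift p * n.+2%:R * x) <= b)%R%:R) y s
    - std_cdf b| <= e.
Proof.
move=> hp e0; have e4 : 0 < e / 4 by rewrite divr_gt0.
have [L0 L00 [tail1 tail2]] := std_cdf_tails e4.
(* These bounds hold from time 1 on, so M does not depend on t0. This permits the order of choices:
   d and eta from M, then t0, then C from t0, and [c0] last. Tail, shift by d, time shift and
   c-error each get e/4. *)
have [M M0 hM] := @heat_bounds R 1 ltr01.
have M8 : M != 0 by rewrite gt_eqF.
have [d d0 Md] : exists2 d : R, 0 < d & M * d = e / 4.
  by exists (e / (4 * M)); [rewrite divr_gt0// mulr_gt0|field].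
have [eta eta0 Meta] : exists2 d : R, 0 < d & 2 * (M * d) = e / 4.
  by exists (e / (8 * M)); [rewrite divr_gt0// mulr_gt0|field].
have [t0 t01 [t0eta L0d]] := small_time L00 d0 eta0.
have t00 : 0 < t0 by case/andP: t01.
have [C C0 hC] := erw_iter_heat hp t00.
exists (Num.min 1 (e / (4 * C))) => [|n c x y s /andP[c0 cmin] nc x1 y1 s2].
  by rewrite lt_min ltr01 divr_gt0// mulr_gt0.
move: cmin; rewrite le_min => /andP[c1 cC].
have {}cC : C * c <= e / 4.
  rewrite (_ : e / 4 = C * (e / (4 * C))); first by rewrite ler_wpM2l// ltW.
  by field; rewrite gt_eqF.
have c01 : 0 < c <= 1 by rewrite c0.
set m := erw_drift p in hC *.
set f := (fun _ s => _%:R).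
have time a : `|heat0 (t0 + 1) a - heat0 1 a| <= e / 4.
  apply: le_trans (@heat0_near1 M a t0 t01 _) _.
    by move=> u v /(hM u v)[].
  by rewrite -Meta ler_wpM2l// ler_wpM2l// ltW.
have space a : `|a| = d -> `|heat0 1 (b + a) - std_cdf b| <= e / 4.
  move=> ad; rewrite -heat0_1.
  apply: le_trans (@heat0_lipschitz _ M 1 _ b a) _.
    by move=> y'; case: (hM 1 y' (lexx _)).
  by rewrite ad Md.
have /andP[_ up] := dist_chain (le_trans (hC n c (b + d) x y s c01 nc x1 y1 s2) cC)
  (time _) (space d (gtr0_norm d0)).
have /andP[down _] := dist_chain (le_trans (hC n c (b - d) x y s c01 nc x1 y1 s2) cC)
  (time _) (space (- d) (etrans (normrN _) (gtr0_norm d0))).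
have fup : erw_iter p x n f y s <= erw_iter p x n
     (fun _ s => heat0 t0 (b + d - c * (s - m * n.+2%:R * x))) y s + e / 4.
  by apply: erw_iter_le => // y' s' _;
    have [] := @heat0_indicator t0 d b (c * (s' - m * n.+2%:R * x)) (e / 4) L0
      L0d t00 tail1 tail2.
have fdown : erw_iter p x n
    (fun _ s => heat0 t0 (b - d - c * (s - m * n.+2%:R * x))) y s <=
    erw_iter p x n f y s + e / 4.
  by apply: erw_iter_le => // y' s' _;
    have [] := @heat0_indicator t0 d b (c * (s' - m * n.+2%:R * x)) (e / 4) L0
      L0d t00 tail1 tail2.
clear -up down fup fdown; rewrite ler_norml.
set u := erw_iter _ _ _ _ _ _ in up fup; set v := erw_iter _ _ _ _ _ _ in down fdown.
set w := erw_iter _ _ _ _ _ _ in fup fdown *; clearbody u v w.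
by apply/andP; split; lra.
Qed.

End Limit.

(** * Cylinder events *)

Section Cylinder.
Context d (T : measurableType d) (R : realType) (P : probability T R).

(** Kept as an explicit finite intersection, so that independence from a fresh source is the product
    formula itself, without generated sigma-algebras. *)
Definition cylinder (I : choiceType) (F : I -> set_system T) (S : pred I)
    (C : set T) : Prop :=
  exists (J : {fset I}) (E : I -> set T),
    (forall i, i \in J -> S i /\ F i (E i)) /\ C = \bigcap_(i in [set` J]) E i.

Lemma cylinderT (I : choiceType) (F : I -> set_system T) (S : pred I) :
  cylinder F S setT.
Proof.
by exists fset0, (fun=> setT); split => //; rewrite set_fset0 bigcap_set0.
Qed.

Lemma cylinder_sub (I : choiceType) (F : I -> set_system T) (S S' : pred I) C :
  (forall i, S i -> S' i) -> cylinder F S C -> cylinder F S' C.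
Proof.
move=> SS' [J [E [JE ->]]]; exists J, E; split => // i /JE[Si Fi].
by split => //; exact: SS'.
Qed.

Lemma cylinder_setI (I : choiceType) (F : I -> set_system T) (S : pred I) C D i :
  mutually_independent P F -> cylinder F S C -> ~~ S i -> F i D ->
  P (C `&` D) = (P C * P D)%E /\ cylinder F (fun j => S j || (j == i)) (C `&` D).
Proof.
move=> indep [J [E [JE ->]]] Si FD.
have iJ : i \notin J by apply: contra Si => /JE[].
pose E' j := if j == i then D else E j.
have E'J j : j \in J -> E' j = E j.
  by rewrite /E'; case: eqP => // -> h; rewrite h in iJ.
have FE' j : j \in (i |` J)%fset -> F j (E' j).
  rewrite in_fset1U /E'; case: eqP => [-> //|_ /= /JE[] //].
have capE : \bigcap_(j in [set` J]) E j = \bigcap_(j in [set` J]) E' j.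
  by apply: eq_bigcapr => j /= jJ; rewrite E'J.
have capE' : \bigcap_(j in [set` (i |` J)%fset]) E' j =
    (\bigcap_(j in [set` J]) E j) `&` D.
  by rewrite bigcap_fsetU1 setIC capE /E' eqxx.
split.
  rewrite -capE' (indep _ _ FE') big_fsetU1//= muleC capE indep; last first.
    by move=> j jJ; rewrite E'J//; case: (JE j jJ).
  by rewrite {2}/E' eqxx.
exists (i |` J)%fset, E'; split; last by rewrite capE'.
move=> j hj; split; last exact: FE'.
by move: hj; rewrite in_fset1U orbC => /orP[/JE[->] //|->]; rewrite orbT.
Qed.

(** D1 and D2 cover the space only up to a null set, which is all that the law of an index
    provides. *)
Lemma probability_split (C D1 D2 : set T) (a1 a2 : R) :
  measurable C -> measurable D1 -> measurable D2 -> D1 `&` D2 = set0 ->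
  P D1 = a1%:E -> P D2 = a2%:E -> a1 + a2 = 1 ->
  P C = (P (C `&` D1) + P (C `&` D2))%E.
Proof.
move=> mC mD1 mD2 D12 P1 P2 a12.
have mU : measurable (D1 `|` D2) by exact: measurableU.
have PU : P (~` (D1 `|` D2)) = 0%E.
  rewrite probability_setC// (_ : P (D1 `|` D2) = 1%E) ?subee//.
  have -> : P (D1 `|` D2) = (P D1 + P D2)%E by exact: measureU.
  by rewrite P1 P2 -EFinD a12.
have -> : P C = (P (C `\` (D1 `|` D2)) + P (C `&` (D1 `|` D2)))%E.
  exact: measureDI.
have -> : P (C `\` (D1 `|` D2)) = 0%E.
  apply: (subset_measure0 _ _ _ PU); [exact: measurableD|exact: measurableC|].
  by move=> w [].
rewrite add0e setIUr; apply: measureU; [exact: measurableI|exact: measurableI|].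
by rewrite setIACA setIid D12 setI0.
Qed.

End Cylinder.

(** * Markov property of the walk *)

Section Walk.
Context d (T : measurableType d) (R : realType) (P : probability T R).
Variables (X : nat -> {RV P >-> R}) (K : nat -> {RV P >-> nat})
  (B : nat -> {RV P >-> bool}) (p : R).
Hypothesis hX : erw_first_last X K B p.

Local Notation sources := (erw_sources X K B).

(** The sources that determine the first n steps: K_j and B_j form step j + 1, hence j < n, where
    [inl k] encodes j = k + 2 and [inr k] encodes j = k + 1. *)
Definition before (n : nat) (i : option (nat + nat)) : bool :=
  match i with
  | None => true
  | Some (inl k) => (k.+2 < n)%N
  | Some (inr k) => (k.+1 < n)%N
  end.

Lemma measurable_first_step (x : R) : measurable [set w | X 1%N w = x].
Proof.
exact: (measurable_funPTI (X 1%N) (measurable_set1 x)).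
Qed.

Lemma measurable_index (n k : nat) : measurable [set w | K n w = k].
Proof.
have mk : measurable [set k] by [].
exact: (measurable_funPTI (K n) mk).
Qed.

Lemma measurable_sign (n : nat) (b : bool) : measurable [set w | B n w = b].
Proof.
have mb : measurable [set b] by [].
exact: (measurable_funPTI (B n) mb).
Qed.

Lemma erw_sources_first (x : R) : sources None [set w | X 1%N w = x].
Proof. by exists [set x]; [exact: measurable_set1|rewrite setTI]. Qed.

Lemma erw_sources_index (n k : nat) :
  sources (Some (inl n)) [set w | K n.+2 w = k].
Proof. by exists [set k]; [|rewrite setTI]. Qed.

Lemma erw_sources_sign (n : nat) (b : bool) :
  sources (Some (inr n)) [set w | B n.+1 w = b].
Proof. by exists [set b]; [|rewrite setTI]. Qed.

Definition sign_weight (b : bool) : R := if b then p else 1 - p.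

Lemma sign_probability (n : nat) (b : bool) : (1 <= n)%N ->
  P [set w | B n w = b] = (sign_weight b)%:E.
Proof. by case: b => hn; [exact: (erw_sign_keep hX)|exact: (erw_sign_flip hX)]. Qed.

Lemma cylinder_step (n k : nat) (b : bool) (C : set T) :
  cylinder sources (before n.+2) C -> (k == 1%N) || (k == n.+2) ->
  P (C `&` [set w | K n.+2 w = k] `&` [set w | B n.+2 w = b]) =
    (P C * (2^-1 * sign_weight b)%:E)%E /\
  cylinder sources (before n.+3)
    (C `&` [set w | K n.+2 w = k] `&` [set w | B n.+2 w = b]).
Proof.
move=> hC hk; have indep := erw_sources_independent hX.
have nb1 : ~~ before n.+2 (Some (inl n)) by rewrite /= ltnn.
have [e1 c1] := cylinder_setI indep hC nb1 (erw_sources_index n k).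
have nb2 : ~~ (before n.+2 (Some (inr n.+1))
    || (Some (inr n.+1) == Some (inl n) :> option (nat + nat))).
  by rewrite /= ltnn.
have [e2 c2] := cylinder_setI indep c1 nb2 (erw_sources_sign n.+1 b).
split.
  rewrite e2 e1 sign_probability// EFinM muleA; congr (_ * _ * _)%E.
  by case/orP: hk => /eqP ->; [exact: (erw_index_first hX)|exact: (erw_index_last hX)].
apply: cylinder_sub c2 => -[[j|j]|] //= /orP[/orP[]|].
all: by [move=> /ltnW|move=> /eqP[->]|move=> /eqP].
Qed.

Lemma cylinder_start (x : R) (b : bool) :
  P ([set w | X 1%N w = x] `&` [set w | B 1%N w = b]) =
    (P [set w | X 1%N w = x] * (sign_weight b)%:E)%E /\
  cylinder sources (before 2)
    ([set w | X 1%N w = x] `&` [set w | B 1%N w = b]).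
Proof.
have indep := erw_sources_independent hX.
have [_ c1] := cylinder_setI (i := None) indep (cylinderT sources pred0) isT
  (erw_sources_first x).
rewrite setTI in c1.
have [e2 c2] := cylinder_setI (i := Some (inr 0%N)) indep c1 isT
  (erw_sources_sign 0 b).
split; first by rewrite e2 sign_probability.
by apply: cylinder_sub c2 => -[[j|j]|] //= /eqP[->].
Qed.

Lemma erw_positionE (n : nat) (w : T) :
  erw_position X n w = \sum_(1 <= k < n.+1) X k w.
Proof.
rewrite /erw_position; elim: n => [|n IH]; first by rewrite !big_geq.
by rewrite !(@big_nat_recr _ _ _ n.+1)//= -IH.
Qed.

Lemma erw_position_recr (n : nat) (w : T) :
  erw_position X n.+1 w = erw_position X n w + X n.+1 w.
Proof. by rewrite !erw_positionE big_nat_recr. Qed.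

(** Countably many almost sure recursions hold together off one null set, so paths can then be
    computed pointwise. *)
Lemma erw_good_set : exists G : set T, [/\ measurable G, P (~` G) = 0%E &
  forall w, G w ->
  X 2%N w = (if B 1%N w then X 1%N w else - X 1%N w) /\
  forall n, (2 <= n)%N ->
    X n.+1 w = if B n w then X (K n w) w else - X (K n w) w].
Proof.
have h : \forall w \ae P, forall n, (2 <= n)%N ->
    X n.+1 w = if B n w then X (K n w) w else - X (K n w) w.
  apply: ae_foralln => n; have [n2|n2] := leqP 2 n.
    by apply: filterS (erw_next_step hX n2) => w hw _.
  by apply: aeW => w.
have [N [mN N0 hN]] := filterI (erw_second_step hX) h.
exists (~` N); split; rewrite ?setCK//; first exact: measurableC.
by move=> w nNw; apply: contrapT => hw; apply: nNw; apply: hN.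
Qed.

Lemma probability_split4 (C D1 D2 E1 E2 : set T) (a1 a2 b1 b2 : R) :
  measurable C -> measurable D1 -> measurable D2 -> D1 `&` D2 = set0 ->
  P D1 = a1%:E -> P D2 = a2%:E -> a1 + a2 = 1 ->
  measurable E1 -> measurable E2 -> E1 `&` E2 = set0 ->
  P E1 = b1%:E -> P E2 = b2%:E -> b1 + b2 = 1 ->
  P C = (P (D1 `&` E1 `&` C) + P (D1 `&` E2 `&` C)
    + (P (D2 `&` E1 `&` C) + P (D2 `&` E2 `&` C)))%E.
Proof.
move=> mC mD1 mD2 D12 PD1 PD2 a12 mE1 mE2 E12 PE1 PE2 b12.
rewrite (probability_split mC mD1 mD2 D12 PD1 PD2 a12).
rewrite (probability_split (measurableI _ _ mC mD1) mE1 mE2 E12 PE1 PE2 b12).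
rewrite (probability_split (measurableI _ _ mC mD2) mE1 mE2 E12 PE1 PE2 b12).
by rewrite ![C `&` _ `&` _]setIC ![C `&` _]setIC ![_ `&` (_ `&` C)]setIA
  ![E1 `&` _]setIC ![E2 `&` _]setIC.
Qed.

Lemma sign_disjoint (n : nat) :
  [set w | B n w = true] `&` [set w | B n w = false] = set0.
Proof. by apply/seteqP; split => // w [/= ->]. Qed.

Lemma sign_weight_sum : sign_weight true + sign_weight false = 1.
Proof. by rewrite /sign_weight addrC subrK. Qed.

(** Induction on the number m of steps to go. The four choices of the next index and sign split C
    into longer cylinders, on which the last step and the position are again known; their weights
    are those of [erw_step]. *)
Lemma cylinder_position (G A : set T) (x : R) (phi : R -> bool) (N : nat) :
  measurable G -> P (~` G) = 0%E ->
  (forall w, G w -> forall n, (2 <= n)%N ->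
    X n.+1 w = if B n w then X (K n w) w else - X (K n w) w) ->
  measurable A ->
  (forall w, G w -> X 1%N w = x -> A w <-> phi (erw_position X N w)) ->
  forall m n (C : set T) (y s : R), (m + n.+2 = N)%N ->
  cylinder sources (before n.+2) C -> measurable C ->
  (forall w, C w -> G w ->
    [/\ X 1%N w = x, X n.+2 w = y & erw_position X n.+2 w = s]) ->
  P (C `&` A) = (P C * (erw_iter p x m (fun _ s => (phi s)%:R) y s)%:E)%E.
Proof.
move=> mG PG recG mA hA; elim=> [|m IH] n C y s hN hC mC hw.
  (* With no step to go, [phi s] decides whether A contains C or misses it, up to the complement of
     G. *)
  have null (D : set T) : measurable D -> (forall w, D w -> ~ G w) -> P D = 0%E.
    move=> mD DG; apply: (subset_measure0 mD (measurableC mG) DG PG).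
  have [phis|phis] := boolP (phi s);
    rewrite [erw_iter _ _ _ _ _ _]/= ?phis ?(negbTE phis) ?mule1 ?mule0; last first.
    apply: null; first exact: measurableI.
    move=> w [Cw Aw] Gw; have [X1 _ Ss] := hw w Cw Gw.
    by move/hA : Aw => /(_ Gw X1); rewrite -hN Ss; exact/negP.
  have -> : P C = (P (C `\` A) + P (C `&` A))%E by exact: measureDI.
  rewrite (null (C `\` A)) ?add0e//; first exact: measurableD.
  move=> w [Cw Aw] Gw; have [X1 _ Ss] := hw w Cw Gw.
  by apply: Aw; apply/(hA w Gw X1); rewrite -hN Ss.
have n12 : 1%N != n.+2 by [].
have sum2 : 2^-1 + 2^-1 = 1 :> R by field.
have idx_disj : [set w | K n.+2 w = 1%N] `&` [set w | K n.+2 w = n.+2] = set0.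
  by apply/seteqP; split => // w [/= ->].
rewrite (probability_split4 (measurableI _ _ mC mA)
  (measurable_index n.+2 1) (measurable_index n.+2 n.+2) idx_disj
  (erw_index_first hX (isT : (2 <= n.+2)%N))
  (erw_index_last hX (isT : (2 <= n.+2)%N)) sum2
  (measurable_sign n.+2 true) (measurable_sign n.+2 false) (sign_disjoint _)
  (sign_probability true (isT : (1 <= n.+2)%N))
  (sign_probability false (isT : (1 <= n.+2)%N)) sign_weight_sum).
have hN' : (m + n.+3 = N)%N by rewrite -hN addnS.
have piece k b z : (k == 1%N) || (k == n.+2) ->
    z = (if b then if k == 1%N then x else y else - (if k == 1%N then x else y)) ->
    P ([set w | K n.+2 w = k] `&` [set w | B n.+2 w = b] `&` (C `&` A)) =
    (P C * (2^-1 * sign_weight b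
      * erw_iter p x m (fun _ s => (phi s)%:R) z (s + z))%:E)%E.
  move=> hk hz.
  have [e c] := cylinder_step b hC hk.
  rewrite setIA [_ `&` C]setIC setIA (IH n.+1 _ z (s + z) hN' c).
  - by rewrite e -muleA -EFinM.
  - apply: measurableI; last exact: measurable_sign.
    by apply: measurableI => //; exact: measurable_index.
  - move=> w [[Cw /= Kw] /= Bw] Gw; have [X1 Xy Ss] := hw w Cw Gw.
    have Xz : X n.+3 w = z.
      rewrite (recG w Gw n.+2 isT) Bw Kw hz.
      by case/orP : hk => /eqP ->; rewrite ?eqxx ?X1 ?Xy.
    by split => //; rewrite erw_position_recr Ss Xz.
rewrite (piece 1%N true x)// (piece 1%N false (- x))//.
rewrite (piece n.+2 true y) ?eqxx ?orbT// (piece n.+2 false (- y)) ?eqxx ?orbT//.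
have -> : P C = (fine (P C))%:E by rewrite fineK ?fin_num_measure.
rewrite -!EFinM -!EFinD; congr (_%:E).
by rewrite /= /erw_step /sign_weight; field.
Qed.

End Walk.

(** * Distribution of the position *)

Section Law.
Context d (T : measurableType d) (R : realType) (P : probability T R).
Variables (X : nat -> {RV P >-> R}) (K : nat -> {RV P >-> nat})
  (B : nat -> {RV P >-> bool}) (p : R).
Hypothesis hX : erw_first_last X K B p.
Hypothesis hX1 : P [set w | X 1%N w = 1] = p%:E.
Hypothesis hX1N : P [set w | X 1%N w = -1] = (1 - p)%:E.

(** X_1 and B_1 give four starts (X_1, X_2, S_2). The test [phi] also takes X_1, because the
    centring of the walk is random through it. *)
Lemma probability_position (m : nat) (A : set T) (phi : R -> R -> bool) :
  measurable A ->
  (forall w, A w <-> phi (X 1%N w) (erw_position X m.+2 w)) ->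
  let q x y s := erw_iter p x m (fun _ s => (phi x s)%:R) y s in
  P A = (p * (p * q 1 1 2 + (1 - p) * q 1 (-1) 0)
    + (1 - p) * (p * q (-1) (-1) (-2) + (1 - p) * q (-1) 1 0))%:E.
Proof.
move=> mA hA q; have [G [mG PG hG]] := erw_good_set hX.
have X1_disj : [set w | X 1%N w = 1] `&` [set w | X 1%N w = -1] = set0.
  apply/seteqP; split => // w [/= -> /eqP].
  by rewrite eq_sym -subr_eq0 -opprD oppr_eq0 -mulr2n pnatr_eq0.
have sum1 : p + (1 - p) = 1 by rewrite addrC subrK.
rewrite (probability_split4 mA (measurable_first_step X 1)
  (measurable_first_step X (-1)) X1_disj hX1 hX1N sum1
  (measurable_sign B 1 true) (measurable_sign B 1 false) (sign_disjoint B 1)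
  (sign_probability hX true (isT : (1 <= 1)%N))
  (sign_probability hX false (isT : (1 <= 1)%N)) (sign_weight_sum p)).
have piece (x y s a : R) (b : bool) : y = (if b then x else - x) -> s = x + y ->
    P [set w | X 1%N w = x] = a%:E ->
    P ([set w | X 1%N w = x] `&` [set w | B 1%N w = b] `&` A) =
    (a * sign_weight p b * q x y s)%:E.
  move=> hy hs hx; have [e c] := cylinder_start hX x b.
  rewrite (@cylinder_position _ _ _ _ _ _ _ _ hX G A x (phi x) m.+2 mG PG _ mA _
    m 0%N _ y s _ c).
  - by rewrite e hx -!EFinM.
  - by move=> w /hG[].
  - by move=> w _ <-; exact: hA.
  - by rewrite addn2.
  - by apply: measurableI; [exact: measurable_first_step|exact: measurable_sign].
  - move=> w [/= X1 Bw] /hG[]; rewrite Bw X1 -hy => Xy _; split => //.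
    rewrite erw_position_recr Xy hs; congr (_ + _).
    by rewrite erw_positionE big_nat1.
rewrite (piece 1 1 2 p true)// (piece 1 (-1) 0 p false) ?subrr//.
rewrite (piece (-1) (-1) (-2) (1 - p) true)//; last by rewrite -opprD.
rewrite (piece (-1) 1 0 (1 - p) false) ?opprK// ?addNr//.
by rewrite -!EFinD; congr (_%:E); rewrite /sign_weight /=; ring.
Qed.

End Law.

(** * Convergence in distribution *)

Lemma convex_dist {R : realType} (p l e a1 a2 a3 a4 : R) : 0 < p < 1 ->
  `|a1 - l| <= e -> `|a2 - l| <= e -> `|a3 - l| <= e -> `|a4 - l| <= e ->
  `|p * (p * a1 + (1 - p) * a2) + (1 - p) * (p * a3 + (1 - p) * a4) - l| <= e.
Proof.
have mix (q a b : R) : 0 < q < 1 -> `|a - l| <= e -> `|b - l| <= e ->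
    `|q * a + (1 - q) * b - l| <= e.
  move=> /andP[q0 q1]; rewrite !ler_norml => /andP[? ?] /andP[? ?].
  by apply/andP; split; nra.
by move=> hp h1 h2 h3 h4; apply: (mix) => //; exact: (mix).
Qed.

Unset Implicit Arguments.

Theorem theorem10p2 (R : realType) (d : measure_display)
    (T : measurableType d) (P : probability T R)
    (p : R) (hp : 0 < p < 1)
    (X : nat -> {RV P >-> R}) (K : nat -> {RV P >-> nat})
    (B : nat -> {RV P >-> bool})
    (hX : erw_first_last X K B p)
    (hX1 : P [set w | X 1%N w = 1] = p%:E)
    (hX1N : P [set w | X 1%N w = -1] = (1 - p)%:E)
    (sigmaT : R) (hsigma : 0 < sigmaT)
    (hsigma2 : sigmaT ^+ 2 =
      1 + (2 * p - 1) * (4 * p ^+ 2 - 24 * p + 19) / (3 - 2 * p) ^+ 3) :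
  cvg_in_distribution
    (fun n : nat => (sigmaT * Num.sqrt n%:R)^-1 *:
      (erw_position X n - ((2 * p - 1) / (3 - 2 * p) * n%:R) *: X 1%N)
      : {RV P >-> R})
    (normal_prob 0 1).
Proof.
have /andP[p0 p1] := hp.
have p32 : 3 - 2 * p != 0 by rewrite gt_eqF//; lra.
have sv : sigmaT ^+ 2 = erw_variance p.
  by rewrite hsigma2 /erw_variance /erw_drift; field.
move=> x _; pose Y (n : nat) : {RV P >-> R} := (sigmaT * Num.sqrt n%:R)^-1 *:
  (erw_position X n - (erw_drift p * n%:R) *: X 1%N).
change (cdf (Y n) x @[n --> \oo] --> normal_prob (0 : R) 1 `]-oo, x]).
have -> : normal_prob (0 : R) 1 `]-oo, x] = (std_cdf x)%:E.
  by rewrite fineK// fin_num_measure.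
apply/fine_cvgP; split; first by near=> n; rewrite fin_num_measure.
apply/cvgrPdist_le => e e0.
have [c0 c00 hc] := erw_iter_cvg x hp e0.
(* The condition says that the scale c is at most [c0]. All four starts have the same limit, hence
   so does their mixture. *)
have close m : (c0 * sigmaT)^-1 <= Num.sqrt m.+2%:R ->
    `|fine (cdf (Y m.+2) x) - std_cdf x| <= e.
  move=> hs; pose c := (sigmaT * Num.sqrt m.+2%:R)^-1.
  have sn0 : 0 < Num.sqrt (m.+2%:R : R) by rewrite sqrtr_gt0.
  have cc0 : 0 < c <= c0.
    rewrite invr_gt0 mulr_gt0//= invf_ple ?posrE ?mulr_gt0//.
    by rewrite mulrC -ler_pdivrMr// -invfM.
  have nc : m.+2%:R * (erw_variance p * c ^+ 2) = 1.
    rewrite -sv /c exprVn exprMn sqr_sqrtr//.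
    by rewrite mulrA [_ * sigmaT ^+ 2]mulrC divff// mulf_neq0 ?expf_neq0 ?pnatr_eq0// gt_eqF.
  pose A := Y m.+2 @^-1` `]-oo, x].
  have mA : measurable A by exact: (measurable_funPTI (Y m.+2)).
  pose phi x1 s := c * (s - erw_drift p * m.+2%:R * x1) <= x.
  have hA w : A w <-> phi (X 1%N w) (erw_position X m.+2 w).
    by rewrite /A /= in_itv/=.
  have -> : fine (cdf (Y m.+2) x) = fine (P A) by [].
  rewrite (probability_position hX hX1 hX1N mA hA) /=.
  have one : 1 ^+ 2 = 1 :> R by rewrite expr1n.
  have onen : (-1) ^+ 2 = 1 :> R by rewrite sqrrN.
  by apply: convex_dist => //; apply: hc; rewrite ?normrN ?normr0 ?ger0_norm.
near=> n; rewrite distrC.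
have n2 : (2 <= n)%N by near: n; exact: nbhs_infty_ge.
have nbig : (c0 * sigmaT)^-1 ^+ 2 <= n%:R by near: n; exact: nbhs_infty_ger.
have nE : n = n.-2.+2 by rewrite -subn2 -addn2 subnK.
rewrite nE; apply: close; rewrite -nE.
have h : 0 <= (c0 * sigmaT)^-1 by rewrite invr_ge0 mulr_ge0// ltW.
by rewrite -(ger0_norm h) -sqrtr_sqr; exact: ler_wsqrtr.
Unshelve. all: by end_near. Qed.
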